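(* If $\underline{\beta} < 0$, then every point $(x,u,y,z,t) \in T$ satisfies $$(u - \underline{\beta} x)(u - \underline{\gamma} x) \leq - \underline{\beta}\, x (t - \underline{\gamma}).$$
   Context: Let $\underline{\gamma} \le \overline{\gamma}$ and $\underline{\beta} \le \overline{\beta}$ be real parameters. The set $T \subseteq \mathbb{R}^5$ consists of all $(x,u,y,z,t)$ satisfying $$u = x t,\quad y + u \le 0,\quad z + x \le 1,\quad y \le \overline{\beta} z,\quad y \ge \underline{\beta} z,\quad z \ge 0,\quad x \in [0,1],\quad t \in [\underline{\gamma}, \overline{\gamma}].$$ *)

(* Defs.v *)
From Stdlib Require Import Reals.
Open Scope R_scope.

(* [gl], [gu] are the lower and upper bounds on [t]; [bl], [bu] are the lower
   and upper slopes bounding [y] against [z].  The components of a point are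
   ordered as (x, u, y, z, t). *)
Definition T (gl gu bl bu : R) (p : R * R * R * R * R) : Prop :=
  let '(x, u, y, z, t) := p in
  u = x * t /\
  y + u <= 0 /\
  z + x <= 1 /\
  y <= bu * z /\
  y >= bl * z /\
  z >= 0 /\
  0 <= x <= 1 /\
  gl <= t <= gu.

(* Main.v *)
Require Import Defs.
From Stdlib Require Import Reals Lra.
Open Scope R_scope.

(** On [T] the factor [u - gl * x] equals [x * (t - gl)], which is nonnegative
    and also occurs on the right-hand side.  The claim is therefore the linear
    bound [u - bl * x <= - bl] multiplied by this factor.  The linear bound
    chains the constraints [u <= - y <= - bl * z <= - bl * (1 - x)]; its last
    step is where the sign of [bl] enters. *)

Theorem theorem3p1 (gl gu bl bu : R) (hgamma : gl <= gu) (hbeta : bl <= bu)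
    (hbl : bl < 0) (x u y z t : R) (hT : T gl gu bl bu (x, u, y, z, t)) :
  (u - bl * x) * (u - gl * x) <= - bl * x * (t - gl).
Proof.
  destruct hT as (hu & hyu & hzx & _ & hyz & _ & [hx _] & [ht _]).
  assert (hz : - bl * z <= - bl * (1 - x)) by (apply Rmult_le_compat_l; lra).
  assert (hlin : u - bl * x <= - bl) by lra.
  assert (hfac : 0 <= x * (t - gl)) by (apply Rmult_le_pos; lra).
  replace (u - gl * x) with (x * (t - gl)) by (rewrite hu; ring).
  rewrite (Rmult_assoc (- bl)).
  now apply Rmult_le_compat_r.
Qed.
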